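(* For $n\ge 1$ let $Z(n)$ be the proportion of permutations $\pi$ of length $n$ (among all $n!$ of them) for which $\mu[1,\pi]=0$. Then $Z(n)$ is asymptotically bounded below by $0.3995$, that is, $\liminf_{n\to\infty} Z(n)\ge 0.3995$.
   Context: Permutations of length $n$ are written in one-line notation $\pi=\pi_1\pi_2\cdots\pi_n$ (a bijection of $\{1,\dots,n\}$). A permutation $\sigma$ is contained in $\pi$, written $\sigma\le\pi$, if some subsequence of $\pi$ (not necessarily of consecutive entries) is order-isomorphic to $\sigma$. This makes the set of all permutations of all lengths a poset; $1$ denotes the permutation of length one. The Möbius function of this poset is defined recursively by $\mu[\sigma,\pi]=0$ if $\sigma\not\le\pi$, $\mu[\sigma,\sigma]=1$, and $\mu[\sigma,\pi]=-\sum_{\sigma\le\tau<\pi}\mu[\sigma,\tau]$ if $\sigma<\pi$. The value $\mu[1,\pi]$ is called the principal Möbius function of $\pi$. *)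

(* Defs.v *)
From HB Require Import structures.
From mathcomp Require Import all_boot all_order all_algebra all_fingroup.
From mathcomp Require Import all_classical all_reals all_analysis.

Set Implicit Arguments.
Unset Strict Implicit.
Unset Printing Implicit Defensive.

Import Order.TTheory GRing.Theory Num.Theory.
Local Open Scope ring_scope.

(* Permutations of arbitrary length.  A permutation of length n is an element
   of 'S_n, so positions and values are numbered from 0 instead of 1.  The
   empty permutation (n = 0) is included; it lies in no interval [sigma, pi]
   with sigma nonempty. *)
Definition permutation : Type := {n : nat & 'S_n}.

Definition as_permutation (n : nat) (p : 'S_n) : permutation :=
  Tagged (fun n => 'S_n) p.

Definition permutation1 : permutation := as_permutation (1%g : 'S_1).

(* The subsequence is given by its strictly increasing list of positions f. *)
Definition contained (sigma pi : permutation) : bool :=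
  let k := tag sigma in let n := tag pi in
  [exists f : {ffun 'I_k -> 'I_n},
    [forall i : 'I_k, forall j : 'I_k, (i < j)%N ==> (f i < f j)%N] &&
    [forall i : 'I_k, forall j : 'I_k,
      (tagged sigma i < tagged sigma j)%N ==
      (tagged pi (f i) < tagged pi (f j))%N]].

Definition strictly_contained (sigma pi : permutation) : bool :=
  contained sigma pi && (sigma != pi).

(* The permutations of length at most n, as a finite type: every permutation
   contained in one of length n is of this form. *)
Definition short_permutation (n : nat) : finType := {m : 'I_n.+1 & 'S_m}.

Definition of_short (n : nat) (t : short_permutation n) : permutation :=
  as_permutation (tagged t).

(* The fuel k bounds the depth of the recursion; any k >= tag pi suffices,
   because strict containment decreases the length. *)
Fixpoint mobius_rec (k : nat) (sigma pi : permutation) : int :=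
  if ~~ contained sigma pi then 0
  else if sigma == pi then 1
  else if k is k'.+1 then
    - \sum_(t : short_permutation (tag pi)
             | contained sigma (of_short t) && strictly_contained (of_short t) pi)
        mobius_rec k' sigma (of_short t)
  else 0.

Definition mobius (sigma pi : permutation) : int :=
  mobius_rec (tag pi) sigma pi.

Lemma contained_refl pi : contained pi pi.
Proof.
apply/existsP; exists [ffun i => i]; apply/andP; split;
  by apply/forallP => i; apply/forallP => j; rewrite !ffunE ?implybb.
Qed.

Lemma contained_incr (m n : nat) (f : {ffun 'I_m -> 'I_n}) :
  [forall i : 'I_m, forall j : 'I_m, (i < j)%N ==> (f i < f j)%N] -> injective f.
Proof.
move=> /forallP fI i j eqf; apply: val_inj => /=.
case: (ltngtP i j) => // lt.
- by have /forallP/(_ j)/implyP/(_ lt) := fI i; rewrite eqf ltnn.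
- by have /forallP/(_ i)/implyP/(_ lt) := fI j; rewrite eqf ltnn.
Qed.

Lemma contained_length sigma pi : contained sigma pi -> (tag sigma <= tag pi)%N.
Proof.
case/existsP => f /andP[/contained_incr/leq_card + _].
by rewrite !card_ord.
Qed.

Lemma incr_geq (n : nat) (f : {ffun 'I_n -> 'I_n}) :
  [forall i : 'I_n, forall j : 'I_n, (i < j)%N ==> (f i < f j)%N] -> forall i : 'I_n, (i <= f i)%N.
Proof.
move=> /forallP fI [i lin]; elim: i lin => [//|i IH] lin /=.
have lin' := ltnW lin.
have /forallP/(_ (Ordinal lin))/implyP/(_ (ltnSn i)) := fI (Ordinal lin').
by apply: leq_ltn_trans; exact: IH.
Qed.

Lemma incr_id (n : nat) (f : {ffun 'I_n -> 'I_n}) :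
  [forall i : 'I_n, forall j : 'I_n, (i < j)%N ==> (f i < f j)%N] -> forall i, f i = i.
Proof.
move=> fI; have inj := contained_incr fI.
have le := incr_geq fI.
suff H : forall k (i : 'I_n), (n - i <= k)%N -> f i = i.
  by move=> i; exact: (H n i (leq_subr _ _)).
elim=> [|k IH] i.
  by rewrite leqn0 subn_eq0 leqNgt ltn_ord.
move=> nik; apply/eqP; rewrite eq_sym; apply/negPn/negP => ne.
have lt : (i < f i)%N by rewrite ltn_neqAle le andbT.
have E : f (f i) = f i.
  apply: IH; rewrite -ltnS; apply: leq_trans nik.
  by rewrite ltn_sub2l.
by move/inj: E => E; rewrite E eqxx in ne.
Qed.

Lemma ord_perm_eq (n : nat) (s t : 'S_n) :
  (forall i j, (s i < s j)%N = (t i < t j)%N) -> s = t.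
Proof.
move=> st; pose f := [ffun i => t ((s^-1)%g i)].
have fI : [forall i : 'I_n, forall j : 'I_n, (i < j)%N ==> (f i < f j)%N].
  apply/forallP => i; apply/forallP => j; apply/implyP => ij.
  by rewrite !ffunE -st !permKV.
apply/permP => i.
by have := incr_id fI (s i); rewrite ffunE permK.
Qed.

Lemma strictly_contained_length sigma pi :
  strictly_contained sigma pi -> (tag sigma < tag pi)%N.
Proof.
case/andP => c; rewrite ltn_neqAle contained_length // andbT.
apply: contraNN => /eqP; case: sigma pi c => m s [n p] /= c e.
subst n; case/existsP: c => /= f /andP[/incr_id fE /forallP H].
suff -> : s = p by [].
by apply: ord_perm_eq => i j; have /forallP/(_ j)/eqP := H i; rewrite !fE.
Qed.

Lemma contained_short sigma pi : contained sigma pi ->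
  exists t : short_permutation (tag pi), of_short t = sigma.
Proof.
case: sigma => m s /contained_length /= le.
by exists (existT _ (Ordinal (le : (m < (tag pi).+1)%N)) s).
Qed.

Lemma of_short_inj (n : nat) : injective (@of_short n).
Proof.
move=> [[i li] s] [[j lj] t] /= E.
have e : i = j by have := congr1 tag E.
subst j; have -> : lj = li by exact: bool_irrelevance.
by move/eqP: E; rewrite /of_short /as_permutation eq_Tagged /= => /eqP ->.
Qed.

Lemma mobius_rec_stable k k' sigma pi :
  (tag pi <= k)%N -> (tag pi <= k')%N ->
  mobius_rec k sigma pi = mobius_rec k' sigma pi.
Proof.
elim: k k' pi => [|k IH] [|k'] pi //= lk lk'.
- case: ifP => // _; case: ifP => // _; rewrite big_pred0 ?oppr0 // => t.
  apply/negP => /andP[_ /strictly_contained_length /leq_trans/(_ lk)].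
  by rewrite ltn0.
- case: ifP => // _; case: ifP => // _; rewrite big_pred0 ?oppr0 // => t.
  apply/negP => /andP[_ /strictly_contained_length /leq_trans/(_ lk')].
  by rewrite ltn0.
case: ifP => // _; case: ifP => // _; congr (- _).
apply: eq_bigr => t /andP[_ /strictly_contained_length lt].
by apply: IH; rewrite -ltnS; apply: leq_trans lt _.
Qed.

Lemma mobius_not_contained sigma pi : ~~ contained sigma pi -> mobius sigma pi = 0.
Proof. by rewrite /mobius; case: (tag pi) => [|n] /= ->. Qed.

Lemma mobius_diag sigma : mobius sigma sigma = 1.
Proof.
by rewrite /mobius; case: (tag sigma) => [|n] /=; rewrite contained_refl eqxx.
Qed.

Lemma mobius_strict sigma pi : strictly_contained sigma pi ->
  mobius sigma pi =
  - \sum_(t : short_permutation (tag pi)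
           | contained sigma (of_short t) && strictly_contained (of_short t) pi)
      mobius sigma (of_short t).
Proof.
move=> sp; have lt := strictly_contained_length sp; case/andP: sp => c ne.
rewrite {1}/mobius (@mobius_rec_stable _ (tag pi).+1) //=.
rewrite c (negPf ne) /=; congr (- _).
apply: eq_bigr => t /andP[_ /strictly_contained_length ltt].
by apply: mobius_rec_stable => //; exact: ltnW.
Qed.

(* The value at n = 0 is irrelevant for the limit inferior. *)
Definition zero_proportion (R : realType) (n : nat) : R :=
  #|[set p : 'S_n | mobius permutation1 (as_permutation p) == 0]|%:R / n`!%:R.

(* Main.v *)
Require Import Defs.
From mathcomp Require Import all_boot all_order all_algebra all_fingroup.
From mathcomp Require Import all_classical all_reals all_analysis.
From mathcomp Require Import zify ring lra.

(* If pi has an increasing adjacency (consecutive positions carrying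
   consecutive increasing values) and a decreasing one, then mu[1, pi] = 0.
   Indeed, let u, d and b be obtained from pi by contracting the first, the
   second, or both.  By induction only those tau < pi count in the recursion
   that do not have adjacencies of both kinds.  For these, tau < pi holds iff
   tau <= u or tau <= d, and tau <= b iff tau <= u and tau <= d.  So the sum of
   mu[1, tau] is the sum over [1, u] plus that over [1, d] minus that over
   [1, b], and all three vanish.

   For a random pi of length n, the numbers of increasing and of decreasing
   adjacencies are asymptotically independent Poisson variables of mean 1,
   which gives the density (1 - 1/e)^2 = 0.39957...  Only the binomial moments
   of the number W of adjacencies of one kind, of the other kind, or of both
   kinds are needed: inserting a new maximum into pi yields a recurrence for
   the expectation of 'C(W, k), whose limit is theta^k / k! with theta = 1 or
   2 the number of kinds; the Bonferroni inequalities then bound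
   1 - P(no increasing) - P(no decreasing) + P(no adjacency) from below. *)

Set Implicit Arguments.
Unset Strict Implicit.
Unset Printing Implicit Defensive.

Import Order.TTheory GRing.Theory Num.Theory.
Import numFieldTopology.Exports numFieldNormedType.Exports.

Local Open Scope nat_scope.

(** * Counting adjacencies *)

(* The flags tu and td select increasing and decreasing adjacencies. *)
Definition adjacent (tu td : bool) (n : nat) (s : 'S_n) (a b : 'I_n) : bool :=
  (b == a.+1 :> nat) &&
  (tu && (s b == (s a).+1 :> nat) || td && (s a == (s b).+1 :> nat)).

Definition adjacencies (tu td : bool) (n : nat) (s : 'S_n) : nat :=
  \sum_a \sum_b adjacent tu td s a b.

Lemma adjacentxx tu td n (s : 'S_n) a : adjacent tu td s a a = false.
Proof. by rewrite /adjacent ltn_eqF. Qed.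

Lemma sum_lift n (i : 'I_n.+1) (F : 'I_n.+1 -> nat) :
  \sum_j F j = F i + \sum_(k < n) F (lift i k).
Proof. by rewrite (@bigD1_ord _ _ _ _ i predT). Qed.

Lemma sum_eq_ord m a : a < m -> \sum_(i < m) (a == i :> nat) = 1.
Proof.
move=> lt; rewrite (bigD1 (Ordinal lt)) //= eqxx big1 // => i.
by rewrite -val_eqE /= eq_sym => /negPf ->.
Qed.

Lemma sum_le1 (I : finType) (F : I -> nat) :
  (forall i, F i <= 1) -> (forall i j, 0 < F i -> 0 < F j -> i = j) ->
  \sum_i F i <= 1.
Proof.
move=> F1 FI; case: (pickP (fun i => 0 < F i)) => [i Fi|F0].
  rewrite (bigD1 i) //= big1 ?addn0 // => j /eqP ne.
  by apply/eqP; rewrite -leqn0 leqNgt; apply/negP => /FI/(_ Fi).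
by rewrite big1 // => i _; have := F0 i; rewrite lt0n => /negbFE/eqP.
Qed.

(** The slot [i] is recovered as the position of the maximum, so insertion is injective, and
    comparing cardinalities makes it bijective. *)
Lemma sum_lift_perm n (F : 'S_n.+1 -> nat) :
  \sum_s F s = \sum_(s : 'S_n) \sum_i F (lift_perm i ord_max s).
Proof.
pose h (x : 'S_n * 'I_n.+1) := lift_perm x.2 ord_max x.1.
have hI : injective h.
  move=> [s i] [t j] /permP /= E.
  have eij : i = j.
    case: (unliftP j i) => // k ei; have := E i.
    rewrite /h /= lift_perm_id ei lift_perm_lift => /eqP.
    by rewrite (negPf (neq_lift _ _)).
  subst j; congr (_, _); apply/permP => k.
  by have := E (lift i k); rewrite /h /= !lift_perm_lift => /lift_inj.
have hB : bijective h.
  by apply: inj_card_bij => //; rewrite card_prod !card_Sn card_ord factS mulnC.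
by rewrite pair_bigA (reindex h) //; apply: onW_bij.
Qed.

(* Inserting a new maximum at position i destroys an adjacency of s lying
   across the slot i, and creates one if i is next to the old maximum. *)
Section Insertion.
Variables (tu td : bool) (n : nat).
Implicit Type s : 'S_n.

Definition broken s (i : 'I_n.+1) : nat :=
  \sum_a \sum_(b : 'I_n) adjacent tu td s a b * (b == i :> nat).

Definition created s (i : 'I_n.+1) : nat :=
  \sum_(a : 'I_n) (td && (a == i :> nat) && ((s a).+1 == n) +
                   (tu && (a.+1 == i :> nat) && ((s a).+1 == n))).

(** Pairs of old positions stay consecutive unless the slot [i] separates them; pairs involving [i]
    are the created ones. The additive form avoids truncated subtraction. *)
Lemma adjacencies_insert s i :
  adjacencies tu td (lift_perm i ord_max s) + broken s i =
  adjacencies tu td s + created s i.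
Proof.
rewrite /adjacencies (sum_lift i) (sum_lift i) adjacentxx add0n.
under [X in _ + X + _]eq_bigr do rewrite (sum_lift i).
rewrite big_split /= -!addnA.
have -> : \sum_(a < n) \sum_(b < n)
    adjacent tu td (lift_perm i ord_max s) (lift i a) (lift i b) + broken s i =
   \sum_a \sum_b adjacent tu td s a b.
  rewrite /broken -big_split /=; apply: eq_bigr => a _.
  rewrite -big_split /=; apply: eq_bigr => b _.
  rewrite /adjacent !lift_perm_lift !lift_max /= /bump.
  set P := (_ || _).
  case: P; rewrite ?andbF ?andbT //; lia.
rewrite addnA [RHS]addnC; congr (_ + _).
rewrite /created -big_split /=; apply: eq_bigr => a _.
rewrite /adjacent !lift_perm_lift !lift_perm_id !lift_max /= /bump.
have := ltn_ord (s a).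
case: tu; case: td => /=; lia.
Qed.

Lemma sum_broken s : \sum_i broken s i = adjacencies tu td s.
Proof.
rewrite exchange_big /=; apply: eq_bigr => a _.
rewrite exchange_big /=; apply: eq_bigr => b _.
by rewrite -big_distrr /= sum_eq_ord ?muln1 // ltnS ltnW.
Qed.

(** The old maximum has one slot before it, which yields a decreasing adjacency, and one after it,
    which yields an increasing one; the empty permutation has no old maximum. *)
Lemma sum_created s : \sum_i created s i = (tu + td) * (0 < n).
Proof.
rewrite exchange_big /=.
transitivity (\sum_(a < n) (tu + td) * ((s a).+1 == n)).
  apply: eq_bigr => a _; rewrite big_split /=.
  have e1 := @sum_eq_ord n.+1 a (ltnW (ltn_ord a)).
  have e2 := @sum_eq_ord n.+1 a.+1 (ltn_ord a).
  case: eqP => _; last by rewrite muln0 !big1 // => i _; rewrite andbF.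
  rewrite muln1 addnC; congr (_ + _).
    by case: tu => /=; [under eq_bigr do rewrite andbT | rewrite big1].
  by case: td => /=; [under eq_bigr do rewrite andbT | rewrite big1].
rewrite -big_distrr /=; congr (_ * _).
transitivity (\sum_(b < n) (b.+1 == n)).
  by rewrite [RHS](reindex_inj (@perm_inj _ s)).
case: (n) => [|m]; first by rewrite big_ord0.
rewrite -[RHS](@sum_eq_ord m.+1 m) //.
by apply: eq_bigr => b _; rewrite eqSS eq_sym.
Qed.

Lemma broken_le1 s i : broken s i <= 1.
Proof.
rewrite /broken pair_bigA; apply: sum_le1 => [[a b]|[a b] [c d]] /=.
  by case: adjacent => //=; case: eqP.
rewrite /adjacent => H1 H2; congr (_, _); apply: val_inj => /=; lia.
Qed.

Lemma broken_le s i : broken s i <= adjacencies tu td s.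
Proof. by rewrite -(sum_broken s) (bigD1 i) //= leq_addr. Qed.

Lemma created_le1 s i : created s i <= 1.
Proof.
apply: sum_le1 => [a|a b H1 H2].
  by case: tu; case: td => /=; lia.
by apply: (@perm_inj _ s); apply: val_inj => /=; move: H1 H2; lia.
Qed.

End Insertion.

Definition top_adjacencies (tu td : bool) (n : nat) (s : 'S_n.+1) : nat :=
  \sum_a \sum_b adjacent tu td s a b * ((s a == n :> nat) + (s b == n :> nat)).

(** A slot that creates is next to the old maximum, so an adjacency broken there has the old maximum
    as one of its two entries. *)
Lemma broken_created_le tu td n (s : 'S_n.+1) :
  \sum_i broken tu td s i * created tu td s i <= top_adjacencies tu td s.
Proof.
apply: (@leq_trans (\sum_(i < n.+2) \sum_a \sum_(b < n.+1)
   adjacent tu td s a b * ((s a == n :> nat) + (s b == n :> nat))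
     * (b == i :> nat))); last first.
  rewrite exchange_big /=; apply: leq_sum => a _.
  rewrite exchange_big /=; apply: leq_sum => b _.
  by rewrite -big_distrr /= sum_eq_ord ?muln1 // ltnS ltnW.
apply: leq_sum => i _; rewrite /broken big_distrl /=; apply: leq_sum => a _.
rewrite big_distrl /=; apply: leq_sum => b _.
case ab: adjacent; rewrite ?mul0n // !mul1n.
case: eqP => [bi|]; rewrite ?mul0n ?muln0 // mul1n muln1.
case: (posnP (created tu td s i)) => [->//|].
rewrite lt0n sum_nat_eq0 negb_forall => /existsP[c] /= cP.
apply: leq_trans (created_le1 _ _ _ _) _.
have [e|e] : c = b :> nat \/ c = a :> nat.
- by move: ab cP; rewrite /adjacent; lia.
- by move/ord_inj: e cP => ->; lia.
- by move/ord_inj: e cP => ->; lia.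
Qed.

(** The adjacencies that involve the new maximum are exactly the created ones. This lets a second
    insertion bound the error term. *)
Lemma top_adjacencies_insert tu td n (s : 'S_n) i :
  top_adjacencies tu td (lift_perm i ord_max s) = created tu td s i.
Proof.
rewrite /top_adjacencies (sum_lift i) (sum_lift i) adjacentxx mul0n add0n.
rewrite -big_split /=; apply: eq_bigr => a _.
rewrite (sum_lift i) big1 ?addn0 => [|b _].
  rewrite /adjacent !lift_perm_lift !lift_perm_id !lift_max /= /bump.
  have := ltn_ord (s a).
  by case: tu; case: td => /=; lia.
by rewrite !lift_perm_lift !lift_max !ltn_eqF ?ltn_ord // muln0.
Qed.

(** * Binomial moments and their recurrence *)

Definition binomial_moment (tu td : bool) (n k : nat) : nat :=
  \sum_(s : 'S_n) 'C(adjacencies tu td s, k).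

(* The error e is present only when an insertion both breaks and creates an
   adjacency. *)
Lemma bin_shift (w b c k : nat) : b <= w -> b <= 1 -> c <= 1 ->
  exists2 e, e <= b * c * 'C(w.-1, k.-1) &
  'C(w + c - b, k.+1) + b * 'C(w.-1, k) + e = 'C(w, k.+1) + c * 'C(w, k).
Proof.
case: b => [|[|//]]; case: c => [|[|//]] bw _ _.
- by exists 0; rewrite ?addn0 ?subn0.
- by exists 0; rewrite ?addn0 ?subn0 // addn1 binS mul1n.
- exists 0; rewrite ?addn0 //; case: w bw => // w _.
  by rewrite subn1 /= binS mul1n.
- case: w bw => // w _; rewrite addnK /= !mul1n.
  case: k => [|k]; first by exists 0; rewrite ?bin0 // addn0.
  by exists 'C(w, k) => //; rewrite [in RHS](binS w k) addnA.
Qed.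

(** Sums [bin_shift] over all permutations of length [n.+1] and all slots; the error is reduced to
    length [n] by viewing those permutations as insertions in turn. *)
Lemma binomial_moment_rec (tu td : bool) n k : exists2 e,
    e <= (tu + td) * binomial_moment tu td n k.-1 &
  binomial_moment tu td n.+2 k.+1 + k.+1 * binomial_moment tu td n.+1 k.+1 + e
  = n.+2 * binomial_moment tu td n.+1 k.+1
    + (tu + td) * binomial_moment tu td n.+1 k.
Proof.
pose W m (s : 'S_m) := adjacencies tu td s.
have /choice [e eP] (x : 'S_n.+1 * 'I_n.+2) : exists e,
    e <= broken tu td x.1 x.2 * created tu td x.1 x.2 * 'C((W _ x.1).-1, k.-1) /\
    'C(W _ (lift_perm x.2 ord_max x.1), k.+1)
      + broken tu td x.1 x.2 * 'C((W _ x.1).-1, k) + e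
    = 'C(W _ x.1, k.+1) + created tu td x.1 x.2 * 'C(W _ x.1, k).
  have [e le eq] := bin_shift k (broken_le tu td x.1 x.2)
    (broken_le1 _ _ _ _) (created_le1 tu td x.1 x.2).
  exists e; split=> //; rewrite -eq; congr ('C(_, _) + _ + _).
  by rewrite -adjacencies_insert addnK.
exists (\sum_s \sum_i e (s, i)).
  apply: (@leq_trans (\sum_(s : 'S_n.+1)
      top_adjacencies tu td s * 'C((W _ s).-1, k.-1))).
    apply: leq_sum => s _.
    apply: leq_trans (leq_mul (broken_created_le tu td s) (leqnn _)).
    by rewrite big_distrl /=; apply: leq_sum => i _; have [] := eP (s, i).
  rewrite sum_lift_perm big_distrr /=; apply: leq_sum => s _.
  apply: (@leq_trans (\sum_i created tu td s i * 'C(W _ s, k.-1))).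
    (* An insertion creates at most one adjacency, so the predecessor of the new count is at most
       the old count. *)
    apply: leq_sum => i _; rewrite top_adjacencies_insert leq_mul2l.
    apply/orP; right; apply: leq_bin2l.
    have := adjacencies_insert tu td s i; have := created_le1 tu td s i.
    rewrite /W; lia.
  rewrite -big_distrl /= sum_created leq_mul2r.
  by case: (0 < n); rewrite ?muln0 ?muln1 ?leqnn orbT.
rewrite /binomial_moment [X in X + _ + _]sum_lift_perm !big_distrr -!big_split /=.
apply: eq_bigr => s _.
have -> : k.+1 * 'C(W _ s, k.+1) = \sum_i broken tu td s i * 'C((W _ s).-1, k).
  by rewrite -big_distrl /= sum_broken mul_bin_diag.
have -> : (tu + td) * 'C(W _ s, k) = \sum_i created tu td s i * 'C(W _ s, k).
  by rewrite -big_distrl /= sum_created muln1.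
have -> : n.+2 * 'C(W _ s, k.+1) = \sum_(i < n.+2) 'C(W _ s, k.+1).
  by rewrite sum_nat_const card_ord.
by rewrite -!big_split /=; apply: eq_bigr => i _; have [] := eP (s, i).
Qed.

(** * Permutations with opposing adjacencies *)

Definition occurrence k n (t : 'S_k) (p : 'S_n) (f : 'I_k -> 'I_n) : Prop :=
  (forall x y, (f x < f y) = (x < y)) /\
  (forall x y, (p (f x) < p (f y)) = (t x < t y)).

Lemma containedP k n (t : 'S_k) (p : 'S_n) :
  reflect (exists f, occurrence t p f)
    (contained (as_permutation t) (as_permutation p)).
Proof.
apply: (iffP existsP) => /= [[f /andP[fI /forallP fO]]|[f [fI fO]]].
  exists f; split=> x y; last by have /forallP/(_ y)/eqP := fO x.
  have mono (a b : 'I_k) : a < b -> f a < f b.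
    by move: fI => /forallP/(_ a)/forallP/(_ b)/implyP; apply.
  apply/idP/idP => [|/mono//]; case: (ltngtP x y) => [//|/mono|/ord_inj ->].
    by case: ltngtP.
  by rewrite ltnn.
exists [ffun x => f x]; apply/andP; split; apply/forallP => x; apply/forallP => y.
  by rewrite !ffunE fI implybb.
by rewrite !ffunE fO.
Qed.

(** An entry of [t] strictly between [x] and [y], in position or in value, would have its image
    strictly between two consecutive numbers. *)
Lemma occurrence_adjacent tu td k n (t : 'S_k) (p : 'S_n) f x y :
  occurrence t p f -> adjacent tu td p (f x) (f y) -> adjacent tu td t x y.
Proof.
move=> [fI fO] /andP[/eqP pos val].
have xy : x < y by rewrite -fI pos.
have yE : y = x.+1 :> nat.
  case: (ltngtP y x.+1) => // lt; first by move: lt xy; lia.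
  have lt' : x.+1 < k by exact: ltn_trans lt (ltn_ord y).
  have := fI x (Ordinal lt'); have := fI (Ordinal lt') y.
  by rewrite /= lt ltnSn; move: pos; lia.
have valS u v : p (f v) = (p (f u)).+1 :> nat -> t v = (t u).+1 :> nat.
  move=> vu; have uv : t u < t v by rewrite -fO vu.
  case: (ltngtP (t v) (t u).+1) => // lt; first by move: lt uv; lia.
  have lt' : (t u).+1 < k by exact: ltn_trans lt (ltn_ord _).
  pose z := (t^-1)%g (Ordinal lt').
  have tz : t z = (t u).+1 :> nat by rewrite permKV.
  by have := fO u z; have := fO z v; rewrite tz lt ltnSn; move: vu; lia.
rewrite /adjacent yE eqxx /=.
by case/orP: val => /andP[-> /eqP/valS ->]; rewrite eqxx ?orbT.
Qed.

Lemma occurrence_shift tu td k n (t : 'S_k) (p : 'S_n) f i j :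
  adjacent tu td p i j -> occurrence t p f -> (forall x, f x != i) ->
  occurrence t p (fun x => if f x == j then i else f x).
Proof.
move=> ij [fI fO] fi.
(* Restates equality of ordinals as equality of numbers, for positions and for values, so that [lia]
   can finish. *)
have tests x : (f x != i :> nat) && (p (f x) != p i :> nat) &&
    ((f x == j) == (f x == j :> nat)) && ((f x == j) == (p (f x) == p j :> nat)).
  by rewrite !(inj_eq (@ord_inj _)) !(inj_eq perm_inj) fi !eqxx.
split=> x y.
  rewrite -fI; move: ij (tests x) (tests y); rewrite /adjacent.
  by case: (f x == j); case: (f y == j); lia.
rewrite -fO; move: ij (tests x) (tests y); rewrite /adjacent.
by case: (f x == j); case: (f y == j); case: tu; case: td; lia.
Qed.

(** Describes the pattern of [p] on the positions [A] only through what it contains, which hides the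
    enumeration of [A]. *)
Definition is_pattern n (p : 'S_n) (A : {set 'I_n}) m (q : 'S_m) : Prop :=
  forall k (t : 'S_k), contained (as_permutation t) (as_permutation q) <->
    exists2 f, occurrence t p f & forall x, f x \in A.

Lemma pattern_on n (p : 'S_n) (A : {set 'I_n}) :
  exists q : 'S_#|A|, is_pattern p A q.
Proof.
pose g (x : 'I_#|A|) := Order.enum_val x.
have gA x : g x \in A by exact: Order.enum_valP.
have gI x y : (g x < g y) = (x < y).
  have := @Order.le_enum_val _ _ (@le_total _ 'I_n) (mem A) y x.
  by rewrite !leEord => H; rewrite ltnNge H -ltnNge.
(* The pattern sends [x] to the rank of its value among the values taken on [A]. *)
have rank_lt x : #|[set y | p (g y) < p (g x)]| < #|A|.
  rewrite -[X in _ < X]card_ord; apply: proper_card; apply/properP; split.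
    by apply/fintype.subsetP.
  by exists x; rewrite // inE ltnn.
pose r x := Ordinal (rank_lt x).
have rO x y : (r x < r y) = (p (g x) < p (g y)).
  have mono a b : p (g a) <= p (g b) -> r a <= r b.
    move=> le; apply/subset_leq_card/fintype.subsetP => c; rewrite !inE => lt.
    exact: leq_trans lt le.
  apply/idP/idP => [|lt]; first by apply: contraTT; rewrite -!leqNgt; exact: mono.
  apply: proper_card; apply/properP; split.
    by apply/fintype.subsetP => c; rewrite !inE => lt'; exact: ltn_trans lt' lt.
  by exists x; rewrite inE ?ltnn.
have rI : injective r.
  move=> x y e; have : p (g x) = p (g y).
    by apply: ord_inj; have := rO x y; have := rO y x; rewrite e ltnn; case: ltngtP.
  by move/perm_inj/Order.enum_val_inj.
exists (perm rI) => k t; split=> [/containedP[f [fI fO]]|[f [fI fO] fA]].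
  exists (g \o f) => [|x]; last exact: gA.
  by split=> x y /=; rewrite ?gI // -rO -fO !permE.
apply/containedP.
have /choice[h hE] x : exists y, g y = f x.
  by exists (Order.enum_rank_in (fA x) (f x)); rewrite /g Order.enum_rankK_in.
by exists h; split=> x y; rewrite ?permE ?rO -?gI !hE.
Qed.

(** * Vanishing of the principal Möbius function *)

Definition has_adjacency (tu td : bool) (pi : permutation) : bool :=
  [exists a, exists b, adjacent tu td (tagged pi) a b].

Definition opposing (pi : permutation) : bool :=
  has_adjacency true false pi && has_adjacency false true pi.

(** The defining recursion with the term of [q] moved to the other side; [1 < tag q] excludes [q]
    being [permutation1]. The bound [N] allows sums for different [q] to share one index type. *)
Lemma mobius_sum_eq0 (q : permutation) (N : nat) : 1 < tag q <= N ->
  (\sum_(t : short_permutation N | contained (of_short t) q)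
     mobius permutation1 (of_short t) = 0)%R.
Proof.
move=> /andP[q1 qN].
have sum_short m : (\sum_(t : short_permutation m | contained (of_short t) q)
    mobius permutation1 (of_short t) = \sum_(l < m.+1) \sum_(s : 'S_l |
      contained (as_permutation s) q) mobius permutation1 (as_permutation s))%R.
  by rewrite sig_big_dep.
transitivity ((\sum_(t : short_permutation (tag q) | contained (of_short t) q)
     mobius permutation1 (of_short t)))%R.
  rewrite !sum_short.
  rewrite [RHS](big_ord_widen N.+1 (fun l => \sum_(s : 'S_l |
    contained (as_permutation s) q) mobius permutation1 (as_permutation s))%R) //.
  rewrite [RHS]big_mkcond /=; apply: eq_bigr => l _; case: ltnP => // lt.
  rewrite big1 // => s /contained_length /=.
  by rewrite leqNgt lt.
have [t0 t0q] := contained_short (contained_refl q).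
rewrite (bigD1 t0) ?t0q ?contained_refl //= mobius_strict.
  apply/eqP; rewrite addrC subr_eq0 big_mkcond [X in _ == X]big_mkcond /=.
  apply/eqP/eq_bigr => t _.
  rewrite /strictly_contained -(inj_eq (@of_short_inj _)) t0q.
  case: (boolP (contained permutation1 _)) => //= c.
  by rewrite mobius_not_contained //; case: ifP.
rewrite /strictly_contained; apply/andP; split; last first.
  by apply/eqP => e; rewrite -e in q1.
case: q q1 {qN sum_short t0 t0q} => n p /= n1.
apply/containedP; exists (fun=> Ordinal (ltnW n1)).
by split=> x y; rewrite (ord1 x) (ord1 y) !ltnn.
Qed.

(** An occurrence through both [a] and [b] gives [t] the adjacency; one that misses [b] is kept; one
    that misses [a] has [b] replaced by [a]. *)
Lemma occurrence_avoid tu td n (p : 'S_n) (A : {set 'I_n}) (a b : 'I_n)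
    k (t : 'S_k) f :
  adjacent tu td p a b -> a \in A -> occurrence t p f -> (forall x, f x \in A) ->
  has_adjacency tu td (as_permutation t) \/
  exists2 f', occurrence t p f' & forall x, f' x \in A :\ b.
Proof.
move=> ab aA fO fA; case: (boolP [exists x, f x == a]) => [/existsP[x /eqP fx]|].
  case: (boolP [exists y, f y == b]) => [/existsP[y /eqP fy]|].
    left; apply/existsP; exists x; apply/existsP; exists y.
    by apply: occurrence_adjacent fO _; rewrite fx fy.
  rewrite negb_exists => /forallP fb; right; exists f => // z.
  by rewrite !inE fb fA.
rewrite negb_exists => /forallP fa; right.
exists (fun x => if f x == b then a else f x).
  exact: occurrence_shift ab fO fa.
move=> z; rewrite !inE; case: ifP => [_|->]; rewrite ?fA ?aA ?andbT //.
by apply: contraTneq ab => ->; rewrite adjacentxx.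
Qed.

(** Sharing a first or a second position forces the same pair, with contradictory values; sharing a
    middle position gives the two outer entries equal values. *)
Lemma opposing_distinct n (p : 'S_n) (i i' j j' : 'I_n) :
  adjacent true false p i i' -> adjacent false true p j j' ->
  [&& i != i', i != j, i != j', i' != j, i' != j' & j != j'].
Proof.
have inj (x y : 'I_n) : x = y :> nat -> p x = p y :> nat by move/ord_inj ->.
have jni (x y : 'I_n) : p x = p y :> nat -> x = y :> nat.
  by move/ord_inj/perm_inj ->.
move: (inj i j) (inj i' j') (inj i j') (inj i' j) (jni i' j) (jni i j').
by rewrite /adjacent -!val_eqE /=; lia.
Qed.

Lemma pattern_strictly_contained n (p : 'S_n) (A : {set 'I_n}) (q : 'S_#|A|) x :
  is_pattern p A q -> x \notin A -> forall t : permutation,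
  contained t (as_permutation q) -> strictly_contained t (as_permutation p).
Proof.
move=> qP xA [k t] tq; rewrite /strictly_contained.
apply/andP; split; first by have /qP[f fO _] := tq; apply/containedP; exists f.
have An : #|A| < n.
  rewrite -[X in _ < X]card_ord; apply: proper_card.
  by apply/fintype.properP; split; [exact: subset_predT | exists x].
have := leq_ltn_trans (contained_length tq) An.
by apply: contraTneq => -> /=; rewrite ltnn.
Qed.

(** The three permutations delete [i'], [j'], or both. A [t] that is not opposing lacks one kind of
    adjacency, so its occurrences can be moved off the corresponding deleted entry. *)
Lemma opposing_contractions (pi : permutation) : opposing pi ->
  exists up down both : permutation,
  [/\ [/\ 1 < tag up <= tag pi, 1 < tag down <= tag pi & 1 < tag both <= tag pi],
      forall t, [|| contained t up, contained t down | contained t both] ->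
        strictly_contained t pi,
      forall t, ~~ opposing t -> strictly_contained t pi ->
        contained t up || contained t down
    & forall t, ~~ opposing t ->
        contained t both = contained t up && contained t down].
Proof.
case: pi => n p /andP[/existsP[i /existsP[i' ii]] /existsP[j /existsP[j' jj]]].
rewrite /= in i i' ii j j' jj.
have /and5P[ii' ij ij' i'j /andP[i'j' jj']] := opposing_distinct ii jj.
pose U : {set 'I_n} := [set: 'I_n]%SET :\ i'.
pose D : {set 'I_n} := [set: 'I_n]%SET :\ j'.
pose B : {set 'I_n} := U :\ j'.
have [iU jU] : i \in U /\ j \in U by rewrite !inE ii' eq_sym i'j.
have [iD jD] : i \in D /\ j \in D by rewrite !inE ij' jj'.
have [iB jB] : i \in B /\ j \in B.
  by rewrite finset.in_setD1 ij' iU finset.in_setD1 jj' jU.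
have [[u uP] [d dP]] := (pattern_on p U, pattern_on p D).
have [b bP] := pattern_on p B.
(* Both [i] and [j] survive each deletion, which keeps the lengths above 1 as [mobius_sum_eq0]
   requires. *)
have card_bound (A : {set 'I_n}) : i \in A -> j \in A -> 1 < #|A| <= n.
  move=> iA jA; apply/andP; split; first by apply/card_gt1P; exists i, j.
  by rewrite -[X in _ <= X]card_ord max_card.
exists (as_permutation u), (as_permutation d), (as_permutation b); split.
- by split; exact: card_bound.
- move=> t /or3P[].
  + by apply: (pattern_strictly_contained uP (x := i')); rewrite !inE eqxx.
  + by apply: (pattern_strictly_contained dP (x := j')); rewrite !inE eqxx.
  + by apply: (pattern_strictly_contained bP (x := j')); rewrite !inE eqxx.
- move=> [k t] opt /andP[/containedP[f fO] _].
  have fT x : f x \in [set: 'I_n]%SET by rewrite inE.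
  have [hu|fu] := occurrence_avoid ii (finset.in_setT i) fO fT; last first.
    by apply/orP; left; apply/uP.
  have [hd|fd] := occurrence_avoid jj (finset.in_setT j) fO fT; last first.
    by apply/orP; right; apply/dP.
  by move: opt; rewrite /opposing hu hd.
move=> [k t] opt; apply/idP/andP.
  move=> /bP[f fO fA]; split; [apply/uP|apply/dP]; exists f => // x;
    by move: (fA x); rewrite /B /U /D !inE => /and3P[a c _]; rewrite ?a ?c.
move=> [/uP[f fO fA] /dP[g gO gA]]; apply/bP.
have [hd|//] := occurrence_avoid jj jU fO fA.
have [hu|[h hO hA]] := occurrence_avoid ii iD gO gA.
  by move: opt; rewrite /opposing hu hd.
by exists h => // x; move: (hA x); rewrite /B /U /D !inE => /and3P[-> ->].
Qed.

Lemma opposing_mobius0 (pi : permutation) :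
  opposing pi -> mobius permutation1 pi = 0%R.
Proof.
have [m] := ubnP (tag pi); elim: m pi => // m IH pi pim op.
have [u [d [b [[un dn bn] below cover both]]]] := opposing_contractions op.
case: (boolP (strictly_contained permutation1 pi)) => [s1|]; last first.
  rewrite /strictly_contained negb_and negbK.
  case/orP => [c|/eqP e]; first exact: mobius_not_contained.
  by move: un; rewrite -e /=; lia.
rewrite (mobius_strict s1); apply/eqP; rewrite oppr_eq0; apply/eqP.
pose M (q : permutation) (t : short_permutation (tag pi)) : int :=
  (if contained (of_short t) q then mobius permutation1 (of_short t) else 0)%R.
(* Each of the three sums vanishes, so it remains to compare the summands for every single [t]. *)
transitivity (\sum_t (M u t + M d t - M b t))%R; last first.
  by rewrite sumrB big_split /= /M -!big_mkcond /= !mobius_sum_eq0 ?addr0 ?subr0.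
rewrite big_mkcond; apply: eq_bigr => t _; rewrite /M.
move: (of_short t) (below (of_short t)) (cover (of_short t)) (both (of_short t)).
move=> {}t {}below {}cover {}both.
transitivity (if strictly_contained t pi then mobius permutation1 t else 0)%R.
  case: (boolP (contained permutation1 t)) => //= c.
  by rewrite mobius_not_contained //; case: ifP.
case: (boolP (opposing t)) => opt.
  have [tpi|/negbTE tpi] := boolP (strictly_contained t pi).
    rewrite IH ?if_same ?addr0 ?subr0 //.
    by have := strictly_contained_length tpi; move: pim; lia.
  move: below; rewrite tpi.
  by case: (contained t u); case: (contained t d); case: (contained t b) => /=;
    rewrite ?addr0 ?subr0 // => /(_ isT).
rewrite (both opt) in below *; have := cover opt.
case: (contained t u) below; case: (contained t d) => //= below.
- by rewrite below // addrK.
- by rewrite below // addr0 subr0.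
- by rewrite below // add0r subr0.
- by case: ifP => // _ /(_ isT).
Qed.

(** * Asymptotics *)

Local Open Scope ring_scope.
Local Open Scope classical_set_scope.

(** With [c] the limit, the error [n.+1%:R * (x n - c)] grows in absolute value by at most [L - y n]
    in absolute value per step once [k <= n]; hence its quotient by [n.+1] tends to 0. *)
Lemma cvg_weighted_mean (R : realType) (x y : nat -> R) (k : nat) (L : R) :
  (forall n, n.+2%:R * x n.+1 = (n.+1%:R - k%:R) * x n + y n) ->
  y @ \oo --> L -> x @ \oo --> L / k.+1%:R.
Proof.
move=> xy yL; set c := L / k.+1%:R.
have cL : c * k.+1%:R = L by rewrite /c divfK // pnatr_eq0.
pose v n := n.+1%:R * `|x n - c|.
have v_step n : (k <= n)%N -> v n.+1 <= v n + `|L - y n|.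
  move=> kn; rewrite /v -[X in X * _]ger0_norm // -normrM.
  have -> : n.+2%:R * (x n.+1 - c) = (n.+1%:R - k%:R) * (x n - c) - (L - y n).
    rewrite mulrBr xy -cL -!natr1; ring.
  apply: le_trans (ler_normB _ _) _; rewrite lerD2r normrM.
  apply: ler_wpM2r => //; rewrite ger0_norm ?subr_ge0 ?ler_nat; last by lia.
  by rewrite lerBlDr lerDl.
apply/cvgrPdist_le => e e0.
have e2 : 0 < e / 2 by lra.
move/cvgrPdist_le : yL => /(_ _ e2)[N0 _ yN].
pose N := maxn N0 k.
have v_bound n : v (n + N)%N <= v N + n%:R * (e / 2).
  elim: n => [|n IH]; first by rewrite mul0r addr0.
  apply: le_trans (v_step (n + N)%N _) _; first by rewrite /N; lia.
  have := yN (n + N)%N; rewrite /= => /(_ ltac:(rewrite /N; lia)) yn.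
  by rewrite -natr1 mulrDl mul1r addrA; apply: lerD.
near=> n.
have nN : (N <= n)%N by near: n; exists N.
(* [v N] is fixed, so half of [e] absorbs it for large [n]; the increments after [N] take the other
   half. *)
have vN : v N <= n.+1%:R * (e / 2).
  rewrite -ler_pdivrMr //; near: n.
  have [M _ HM] := @nbhs_infty_ger R (v N / (e / 2)).
  by exists M => // n Mn; apply: le_trans (HM n Mn) _; rewrite ler_nat.
have := v_bound (n - N)%N; rewrite subnK // => vn.
rewrite distrC -(ler_pM2l (ltr0Sn R n)) -/(v n).
apply: le_trans vn _.
have : (n - N)%N%:R <= n.+1%:R :> R by rewrite ler_nat; lia.
move=> /(ler_wpM2r (ltW e2)) h; apply: le_trans (lerD vN h) _.
by rewrite -mulrDr -splitr.
Unshelve. all: by end_near. Qed.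

Definition moment (R : realType) (tu td : bool) (k n : nat) : R :=
  (binomial_moment tu td n k)%:R / n`!%:R.

(** After division by a factorial, [binomial_moment_rec] has the form treated by
    [cvg_weighted_mean]. Strong induction is used because the error involves the moment of order
    [k.-1]. *)
Lemma moment_cvg (R : realType) (tu td : bool) (k : nat) :
  moment R tu td k @ \oo --> \prod_(i < k) ((tu + td)%N%:R / i.+1%:R : R).
Proof.
have fact_neq0 n : n`!%:R != 0 :> R by rewrite pnatr_eq0 -lt0n fact_gt0.
elim/ltn_ind: k => -[_|k IH].
  rewrite big_ord0; apply: cvg_near_cst; apply: nearW => n; rewrite /moment.
  rewrite /binomial_moment; under eq_bigr do rewrite bin0.
  by rewrite sum1_card card_Sn divff.
rewrite big_ord_recr /= mulrA -(@cvg_shiftS R).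
pose x n := moment R tu td k.+1 n.+1.
(* Chosen so that the recurrence for [x] holds by definition; its limit comes from the squeeze
   [yE]. *)
pose y n := n.+2%:R * x n.+1 - (n.+1%:R - k%:R) * x n.
set th := (tu + td)%N%:R.
have yE n : th * moment R tu td k n.+1 - th * moment R tu td k.-1 n / n.+1%:R <= y n
    <= th * moment R tu td k n.+1.
  have [e le eq] := binomial_moment_rec tu td n k.
  have -> : y n = th * moment R tu td k n.+1 - e%:R / n.+1`!%:R.
    have {}eq := congr1 (fun m => m%:R : R) eq.
    rewrite natrD natrD [in RHS]natrD !natrM -/th in eq.
    rewrite /y /x /moment (factS n.+1) [(n.+2 * _)%N%:R]natrM.
    set T := (binomial_moment tu td n.+2 k.+1)%:R in eq *.
    have -> : T = n.+2%:R * (binomial_moment tu td n.+1 k.+1)%:R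
        + th * (binomial_moment tu td n.+1 k)%:R
        - k.+1%:R * (binomial_moment tu td n.+1 k.+1)%:R - e%:R.
      by rewrite -eq; ring.
    have := fact_neq0 n.+1; have n2 : (n.+2%:R : R) != 0 by rewrite pnatr_eq0.
    move: n2; rewrite -[n.+2%:R]natr1 -[k.+1%:R]natr1 => n2 n1.
    by field; rewrite n1 nat1r.
  apply/andP; split; last by rewrite gerDl oppr_le0 divr_ge0.
  rewrite lerD2l lerN2 ler_pdivrMr ?ltr0n ?fact_gt0 //.
  have -> : th * moment R tu td k.-1 n / n.+1%:R * n.+1`!%:R =
      ((tu + td) * binomial_moment tu td n k.-1)%:R.
    rewrite /moment factS !natrM -/th; field.
    by rewrite fact_neq0 nat1r pnatr_eq0.
  by rewrite ler_nat.
apply: (@cvg_weighted_mean _ x y).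
  by move=> n; rewrite /y addrC subrK.
have c1 : (fun n => th * moment R tu td k n.+1) @ \oo -->
    th * \prod_(i < k) (th / i.+1%:R).
  by apply: cvgMr; rewrite (@cvg_shiftS R); apply: IH.
have -> : \prod_(i < k) (th / i.+1%:R) * th = th * \prod_(i < k) (th / i.+1%:R).
  by rewrite mulrC.
apply: (squeeze_cvgr (f := fun n => th * moment R tu td k n.+1
    - th * moment R tu td k.-1 n / n.+1%:R) _ _ c1); first exact: nearW.
rewrite -[X in _ --> X]subr0; apply: cvgB => //.

(* The error is a convergent moment times the harmonic sequence, so it tends to 0. *)
rewrite -[X in _ --> X](mulr0 (th * \prod_(i < k.-1) (th / i.+1%:R))).
apply: cvgM; last exact: cvg_harmonic.
by apply: cvgMr; apply: IH; lia.
Qed.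

(** * Bonferroni inequalities *)

Lemma alternating_bin_sum (R : comNzRingType) (w K : nat) :
  \sum_(k < K.+1) (-1) ^+ k * 'C(w.+1, k)%:R = (-1) ^+ K * 'C(w, K)%:R :> R.
Proof.
elim: K => [|K IH]; first by rewrite big_ord_recr big_ord0 /= add0r !bin0.
by rewrite big_ord_recr /= IH binS natrD exprS; ring.
Qed.

(* The Bonferroni truncation of the inclusion-exclusion formula for [w = 0]. *)
Definition sieve (R : comNzRingType) (K w : nat) : R :=
  \sum_(k < K.+1) (-1) ^+ k * 'C(w, k)%:R.

Lemma sieve0 (R : comNzRingType) (K : nat) : sieve R K 0 = 1.
Proof.
by rewrite /sieve big_ord_recl big1 ?addr0 ?mulr1 // => k _; rewrite bin0n mulr0.
Qed.

(** For positive [w] the truncated sum is a single binomial coefficient whose sign is the parity of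
    [K]. *)
Lemma sieve_ge (R : numDomainType) (K w : nat) : ~~ odd K ->
  (w == 0)%N%:R <= sieve R K w.
Proof.
case: w => [|w] K2; first by rewrite sieve0.
by rewrite /sieve alternating_bin_sum -signr_odd (negbTE K2) mul1r.
Qed.

Lemma sieve_le (R : numDomainType) (K w : nat) : odd K ->
  sieve R K w <= (w == 0)%N%:R.
Proof.
case: w => [|w] K1; first by rewrite sieve0.
by rewrite /sieve alternating_bin_sum -signr_odd K1 mulN1r oppr_le0.
Qed.

Lemma sieve_mean_cvg (R : realType) (tu td : bool) (K : nat) :
  (fun n => (\sum_(s : 'S_n) sieve R K (adjacencies tu td s)) / n`!%:R) @ \oo -->
  \sum_(k < K.+1) (-1) ^+ k * \prod_(i < k) ((tu + td)%N%:R / i.+1%:R : R).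
Proof.
have -> : (fun n => (\sum_(s : 'S_n) sieve R K (adjacencies tu td s)) / n`!%:R) =
    (fun n => \sum_(k < K.+1) (-1) ^+ k * moment R tu td k n).
  apply/funext => n; rewrite exchange_big mulr_suml; apply: eq_bigr => k _.
  by rewrite -mulr_sumr -mulrA /moment /binomial_moment natr_sum.
apply: (cvg_big (@add_continuous R^o)) => k _.
by apply: cvgMr; exact: moment_cvg.
Qed.

Lemma has_adjacencyE tu td n (s : 'S_n) :
  has_adjacency tu td (as_permutation s) = (adjacencies tu td s != 0%N).
Proof.
rewrite sum_nat_eq0 negb_forall; apply: eq_existsb => a.
rewrite sum_nat_eq0 negb_forall; apply: eq_existsb => b.
by rewrite eqb0 negbK.
Qed.

(** No pair of positions is both increasing and decreasing, so the two counts add up. *)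
Lemma adjacencies_both n (s : 'S_n) :
  (adjacencies true true s = adjacencies true false s + adjacencies false true s)%N.
Proof.
rewrite -big_split /=; apply: eq_bigr => a _; rewrite -big_split /=.
by apply: eq_bigr => b _; rewrite /adjacent /=; lia.
Qed.

(* The truncation levels 8 and 11 are large enough for the error to fit in the
   gap of about 7.6e-5 between 0.3995 and (1 - 1/e)^2. *)
Lemma zero_proportion_ge (R : realType) (n : nat) :
  1 - (\sum_(s : 'S_n) sieve R 8 (adjacencies true false s)) / n`!%:R
    - (\sum_(s : 'S_n) sieve R 8 (adjacencies false true s)) / n`!%:R
    + (\sum_(s : 'S_n) sieve R 11 (adjacencies true true s)) / n`!%:R
  <= zero_proportion R n.
Proof.
have f0 : 0 < n`!%:R :> R by rewrite ltr0n fact_gt0.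
rewrite /zero_proportion ler_pdivlMr // mulrDl !mulrBl !divfK ?lt0r_neq0 // mul1r.
rewrite -[X in _ <= X%:R]sum1_card natr_sum -card_Sn -sum1_card natr_sum.
rewrite -!sumrB -big_split /= [leRHS]big_mkcond /=.
(* With [u] and [d] the two counts, the sieves give at most 1 - [u = 0] - [d = 0] + [u + d = 0],
   which is 1 when both are positive and 0 otherwise. *)
apply: ler_sum => s _; rewrite inE.
have Hu := sieve_ge R (adjacencies true false s) (isT : ~~ odd 8).
have Hd := sieve_ge R (adjacencies false true s) (isT : ~~ odd 8).
have := sieve_le R (adjacencies true true s) (isT : odd 11).
rewrite adjacencies_both addn_eq0 => Hb.
have := @opposing_mobius0 (as_permutation s); rewrite /opposing !has_adjacencyE.
move: Hu Hd Hb; case: eqP => _; case: eqP => _ /= Hu Hd Hb m0;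
  [case: ifP => _; lra.. | by rewrite m0 // eqxx; lra].
Qed.

Theorem theorem9 (R : realType) :
  (((3995%:R / 10%:R ^+ 4)%R : R)%:E <=
     limn_einf (fun n : nat => (zero_proportion R n)%:E))%E.
Proof.
rewrite limn_einf_lim; apply: lime_ge; first exact: is_cvg_einfs.
pose L (tu td : bool) K : R :=
  \sum_(k < K.+1) (-1) ^+ k * \prod_(i < k) ((tu + td)%N%:R / i.+1%:R).
pose mean tu td K n : R :=
  (\sum_(s : 'S_n) sieve R K (adjacencies tu td s)) / n`!%:R.
have lim : (fun n => 1 - mean true false 8 n - mean false true 8 n
    + mean true true 11 n) @ \oo -->
    1 - L true false 8 - L false true 8 + L true true 11.
  by apply: cvgD; [apply: cvgB; [apply: cvgB; [exact: cvg_cst|]|]|];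
    exact: sieve_mean_cvg.
have [] := cvgr_ge _ lim (3995%:R / 10%:R ^+ 4).
  (* Over ranges of natural numbers the sums and products unfold to explicit rationals, and a
     numerical comparison is left to [lra]. *)
  have LE tu td K : L tu td K = \sum_(0 <= k < K.+1)
      (-1) ^+ k * \prod_(0 <= i < k) ((tu + td)%N%:R / i.+1%:R).
    by rewrite big_mkord; apply: eq_bigr => k _; rewrite big_mkord.
  rewrite !LE /index_iota !subn0 unlock /=.
  lra.
move=> N _ HN; exists N => // n Nn; apply: le_ereal_inf_tmp => _ [m /= nm <-].
rewrite lee_fin; apply: le_trans (zero_proportion_ge R m).
exact: HN (leq_trans Nn nm).
Qed.
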